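(* Let $k=\mathbb C$. Let $p$ be a prime number, $n\ge 3$ an integer such that $p\mid n$, and $\lambda_1,\dots,\lambda_n$ distinct elements of $k$. Let $f(x)=\prod_{i=1}^n(x-\lambda_i)$ and let $X=Z(y^p-f(x))$, an affine curve in $\mathbb A^2$. For a sufficiently general choice of $\lambda_1,\dots,\lambda_n$, the group of units $\mathcal O^\ast(X)$ is equal to $k^\ast$.
   Context: $Z(g)$ is the zero set of $g$; $\mathcal O(X)=k[x,y]/(y^p-f(x))$ is the coordinate ring of $X$ and $\mathcal O^\ast(X)$ is its group of units. ''For a sufficiently general choice of $\lambda_1,\dots,\lambda_n$'' means: for all $(\lambda_1,\dots,\lambda_n)\in\mathbb C^n$ with distinct entries outside some countable union of proper Zariski-closed subsets of $\mathbb C^n$ (depending only on $n$ and $p$). *)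

(* Defs.v *)
From HB Require Import structures.
From mathcomp Require Import all_boot all_order all_algebra.
From mathcomp Require Import boolp classical_sets reals.
From mathcomp Require Import complex.
From mathcomp Require Import mpoly.

Set Implicit Arguments.
Unset Strict Implicit.
Unset Printing Implicit Defensive.
Import Order.TTheory GRing.Theory Num.Theory.

Local Open Scope ring_scope.
Local Open Scope classical_set_scope.

Definition zariski_closed (k : comNzRingType) (n : nat)
    (Z : set ('I_n -> k)) : Prop :=
  exists S : set {mpoly k[n]},
    Z = [set v | forall q : {mpoly k[n]}, S q -> q.@[v] = 0].

(* "[P lam] for a sufficiently general choice of distinct
   lam_1, ..., lam_n in k".  Since the empty set is a proper closed subset
   for n > 0, families indexed by [nat] cover all countable families. *)
Definition sufficiently_general (k : comNzRingType) (n : nat)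
    (P : ('I_n -> k) -> Prop) : Prop :=
  exists Z : nat -> set ('I_n -> k),
    (forall j, zariski_closed (Z j) /\ Z j <> setT) /\
    (forall lam : 'I_n -> k,
       injective lam -> ~ (\bigcup_j Z j) lam -> P lam).

(* k[x,y] is represented as [{poly {poly k}}]: the inner variable is x, the
   outer one is y. *)
Definition superelliptic_eq (k : comNzRingType) (p : nat) (f : {poly k}) :
    {poly {poly k}} :=
  'X^p - f%:P.

Definition coord_ring (k : comNzRingType) (p : nat) (f : {poly k}) : comNzRingType :=
  {poly %/ superelliptic_eq p f}.

(* [{poly %/ h}] is by definition the quotient by [mk_monic h], which falls
   back to 'X unless [h] is monic and nonconstant; the fallback never occurs
   here for p > 0. *)
Lemma mk_monic_superelliptic_eq (k : comNzRingType) (p : nat) (f : {poly k}) :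
  (0 < p)%N -> mk_monic (superelliptic_eq p f) = superelliptic_eq p f.
Proof.
move=> p_gt0; rewrite /mk_monic /superelliptic_eq.
by rewrite size_XnsubC // ltnS p_gt0 monicXnsubC.
Qed.

(* The [unitRingType] structure on [{poly %/ h}] is only available when the
   coefficients form a field, hence this direct definition. *)
Definition ring_units (A : comNzRingType) : set A :=
  [set u | exists v : A, u * v = 1].
Arguments ring_units : clear implicits.

(* The image of k^* under the structure map k -> k[x] -> O(X). *)
Definition nonzero_constants (k : fieldType) (p : nat) (f : {poly k}) :
    set (coord_ring p f) :=
  [set qpolyC (superelliptic_eq p f) c%:P | c in [set c : k | c != 0]].
Arguments nonzero_constants {k} p f.

(* Main.v *)
From HB Require Import structures.
Require Import Defs.
From mathcomp Require Import all_boot all_order all_algebra.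
From mathcomp Require Import boolp classical_sets reals.
From mathcomp Require Import cyclic separable cyclotomic.
From mathcomp Require Import complex.
From mathcomp Require Import mpoly.
From mathcomp Require Import ring zify.

Set Implicit Arguments.
Unset Strict Implicit.
Unset Printing Implicit Defensive.
Import Order.TTheory GRing.Theory Num.Theory.

Local Open Scope ring_scope.
Local Open Scope classical_set_scope.

(** Let [n = p * m].  The curve [y^p = f(x)] has [p] points at infinity, one
    for each p-th root of unity [zeta]: in the coordinate [t = 1/x], the branch
    at that point is [y = zeta t^-m g(t)], where [g] is the p-th root of
    [prod_i (1 - lam_i t)] with [g(0) = 1].  A unit of the coordinate ring has
    its zeros and poles among these points, hence has total order [0] there;
    so it is enough to exclude nonzero functions whose orders at infinity are
    bounded below by an integer vector of sum [>= 0] other than the zero vector.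

    For a fixed such vector, and for polynomials [u(x, y)] of bounded degree,
    the required vanishing at infinity is a homogeneous linear system in the
    coefficients of [u], whose matrix depends polynomially on [lam]
    ([root_series] is compatible with specialization).  If this system has no
    nonzero solution at one particular point [lam], it has none outside a
    hypersurface ([generic_injectivity]).  The vectors of orders and the degree
    bounds are countably many, which gives the countable family of closed sets.

    The particular point is [lam = (1, 0, ..., 0)], where the curve degenerates
    to the rational curve [y^p = x^(n-1) (x - 1)].  There [t = 1 - w^p] with
    [w = y / x^m], so that [u], cleared of its poles, becomes a polynomial
    [B(w)].  The conditions say that [B] is divisible by
    [prod_j (w - zeta^j)^(e_j)], where the [e_j] are the bounds on the orders,
    shifted by the exponent of [t] that clears the poles.  This product has
    degree at least the bound on the degree of [B]; so, unless it vanishes, [B]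
    is a constant multiple of it.  The singular point [w = oo] of
    the curve leaves a gap below the top degree of [B] as soon as [n >= 3],
    which reads [sum_j e_j zeta^j = 0]; as [p] is prime, all the [e_j] are then
    equal ([vanishing_sum_prime_roots]), which contradicts the choice of the
    vector ([rational_polar_injective]).

    Outside the hypersurfaces, a unit [u] therefore has order [0] at every
    point at infinity; subtracting from [u] its value at one of them yields a
    function with orders [(>= 1, >= 0, ..., >= 0)], which is again excluded
    unless it vanishes.  Hence [u] is constant ([unit_constant]). *)

(** * Integral relations between the p-th roots of unity *)

(** This is [((X + 1)^p - 1) / X], which for prime [p] is the p-th cyclotomic
    polynomial in [X + 1]. *)
Definition shifted_cyclotomic (p : nat) : {poly int} :=
  \poly_(i < p) ('C(p, i.+1))%:Z.

Lemma size_shifted_cyclotomic p : size (shifted_cyclotomic p) = p.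
Proof.
case: p => [|p]; first by apply/eqP; rewrite -leqn0 size_poly.
by apply: size_poly_eq; rewrite binn.
Qed.

Lemma shifted_cyclotomicX (A : comNzRingType) p :
  map_poly intr (shifted_cyclotomic p) * 'X = ('X + 1) ^+ p - 1 :> {poly A}.
Proof.
apply/polyP => -[|i]; rewrite coefMX /=.
  by rewrite -horner_coef0 !hornerE expr1n subrr.
rewrite coef_map coef_poly coefB coef1 subr0 addrC exprDn coef_sum.
have -> : \sum_(j < p.+1) ((1 ^+ (p - j) * 'X ^+ j) *+ 'C(p, j) : {poly A})`_i.+1
   = \sum_(j < p.+1 | j == i.+1 :> nat) ('C(p, j))%:R.
  rewrite [RHS]big_mkcond /=; apply: eq_bigr => j _.
  by rewrite expr1n mul1r coefMn coefXn eq_sym; case: eqP => // _; rewrite mul0rn.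
rewrite (big_ord1_eq _ (fun j => ('C(p, j))%:R)) ltnS.
by case: ifP => // _; rewrite rmorph0.
Qed.

Lemma shifted_cyclotomic_irreducible p : prime p ->
  irreducible_poly (map_poly (intr : int -> rat) (shifted_cyclotomic p)).
Proof.
move=> pp; have p_gt1 := prime_gt1 pp; have p_gt0 := ltnW p_gt1.
apply/irreducible_rat_int/(eisenstein_crit pp).
- by rewrite size_shifted_cyclotomic neq_ltn p_gt1 orbT.
- rewrite lead_coefE size_shifted_cyclotomic coef_poly prednK // leqnn binn.
  by rewrite dvdzE absz_nat dvdn1 neq_ltn p_gt1 orbT.
- rewrite coef_poly p_gt0 bin1 dvdzE /= gtnNdvd //.
  by rewrite (_ : p ^+ 2 = (p * p)%N) // ltn_Pmulr.
- move=> i; rewrite size_shifted_cyclotomic => lt_ip.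
  rewrite coef_poly ifT ?dvdzE /=; last by rewrite (leq_trans lt_ip) ?leq_pred.
  by rewrite prime_dvd_bin // ltnS /= -(ltn_predK p_gt1) ltnS.
Qed.

(** The polynomial [P = sum_j e_j X^j] has degree less than [p], and vanishes
    at [z] together with the irreducible cyclotomic polynomial, of degree
    [p - 1]; so it is a rational multiple of [1 + X + ... + X^(p-1)]. *)
Lemma vanishing_sum_prime_roots (K : numFieldType) p (z : K) (e : 'I_p -> nat) :
  prime p -> p.-primitive_root z -> \sum_j (e j)%:R * z ^+ j = 0 ->
  forall i j, e i = e j.
Proof.
move=> pp prim_z; have p_gt1 := prime_gt1 pp; have p_gt0 := ltnW p_gt1.
pose S : {poly rat} := map_poly intr (shifted_cyclotomic p).
pose P : {poly rat} := \sum_(j < p) (e j)%:R *: 'X^j; move=> Pz0.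
have szS : size S = p.
  by rewrite size_map_inj_poly ?size_shifted_cyclotomic //; apply: intr_inj.
have coefP (j : 'I_p) : P`_j = (e j)%:R.
  rewrite coef_sum (bigD1 j) //= coefZ coefXn eqxx mulr1 big1 ?addr0 // => i.
  by rewrite coefZ coefXn -val_eqE eq_sym => /negPf /= ->; rewrite mulr0.
have szP : (size P <= p)%N.
  rewrite (leq_trans (size_sum _ _ _)) //; apply/bigmax_leqP => j _.
  by rewrite (leq_trans (size_scale_leq _ _)) // size_polyXn.
have S_dvd : S %| P \Po ('X + 1).
  apply: contraT; rewrite -irreducible_poly_coprime; last first.
    exact: shifted_cyclotomic_irreducible.
  rewrite -(coprimep_map (@ratr K)) => /(@coprimep_root _ _ _ (z - 1)) /implyP.
  rewrite map_comp_poly rmorphD rmorph1 /= map_polyX horner_comp !hornerE.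
  rewrite subrK rmorph_sum /= horner_sum.
  have -> : \sum_(j < p) (map_poly ratr ((e j)%:R *: 'X^j)).[z] = 0.
    rewrite -[RHS]Pz0; apply: eq_bigr => j _.
    by rewrite map_polyZ map_polyXn !hornerE rmorph_nat.
  rewrite eqxx implybF -map_poly_comp.
  have z1n0 : z - 1 != 0.
    rewrite subr_eq0; apply: contraTneq p_gt1 => z1.
    by rewrite -leqNgt dvdn_leq // (prim_order_dvd prim_z) z1 expr1.
  move/negP; case; rewrite rootE -(inj_eq (mulIf z1n0)) mul0r.
  rewrite -{2}(hornerX (z - 1)) -hornerM.
  rewrite (eq_map_poly (g := intr)) => [|b]; last by rewrite /= rmorph_int.
  by rewrite shifted_cyclotomicX !hornerE subrK (prim_expr_order prim_z) subrr.
have [c Pc] : exists c : rat, P \Po ('X + 1) = c *: S.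
  have [q def_q] := dvdpP _ _ S_dvd.
  suff sz_q : (size q <= 1)%N.
    by exists q`_0; rewrite def_q (size1_polyC sz_q) mul_polyC coefC.
  have [-> | q_neq0] := eqVneq q 0; first by rewrite size_poly0.
  have S_neq0 : S != 0 by rewrite -size_poly_gt0 szS.
  have := congr1 (fun r : {poly rat} => size r) def_q.
  rewrite size_comp_poly2 ?size_XaddC // size_mul // szS => szPq.
  move: szP; rewrite szPq; case: (size q) => // k.
  by rewrite addSn /= -[X in (_ <= X)%N]add0n leq_add2r.
have PX : P * ('X - 1) = c *: ('X ^+ p - 1).
  have := congr1 (fun q => (q * 'X) \Po ('X - 1)) Pc.
  rewrite /= -scalerAl shifted_cyclotomicX comp_polyZ !(comp_polyM, comp_polyB).
  rewrite -comp_polyA comp_polyD comp_polyX comp_polyC subrK comp_polyXr.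
  by rewrite rmorphXn /= comp_polyD comp_polyX comp_polyC subrK.
suff ePc (j : 'I_p) : P`_j = c.
  by move=> i j; apply/eqP; rewrite -(eqr_nat rat) -!coefP !ePc.
case: j => j /=; elim: j => [|j IHj] lt_jp.
  have /(congr1 (coefp 0)) := PX; rewrite /= coefZ mulrBr mulr1 !coefB coefMX.
  rewrite coefXn coef1 (ltn_eqF p_gt0) /= !sub0r mulrN1.
  by move/oppr_inj.
have /(congr1 (coefp j.+1)) := PX; rewrite /= coefZ mulrBr mulr1 !coefB coefMX.
rewrite coefXn coef1 (ltn_eqF lt_jp) /= subrr mulr0 IHj ?(ltnW lt_jp) //.
by move/eqP; rewrite subr_eq0 => /eqP.
Qed.

(** * Truncated p-th roots of power series *)

(** Hensel approximation of the p-th root of [F], for [F] of constant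
    coefficient [1].  The argument [c] stands for the inverse of [p]: this makes
    the construction available over polynomial rings, and compatible with
    ring morphisms. *)
Fixpoint root_series (A : comNzRingType) (p : nat) (c : A) (F : {poly A}) N :=
  if N is N'.+1 then
    let g := root_series p c F N' in g + (c * (F - g ^+ p)`_N)%:P * 'X^N
  else 1.

Lemma map_root_series (A B : comNzRingType) (f : {rmorphism A -> B}) p c F N :
  map_poly f (root_series p c F N) = root_series p (f c) (map_poly f F) N.
Proof.
elim: N => [|N IHN]; first by rewrite rmorph1.
rewrite [in LHS]/= rmorphD rmorphM /= map_polyC map_polyXn IHN /= rmorphM /=.
by rewrite -coef_map rmorphB rmorphXn /= IHN.
Qed.

Lemma root_series0 (A : comNzRingType) p (c : A) F N :
  (root_series p c F N)`_0 = 1.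
Proof.
elim: N => [|N IHN] /=; first by rewrite coef1.
by rewrite coefD IHN coefMXn /= addr0.
Qed.

Lemma root_seriesP (K : fieldType) p (F : {poly K}) N :
  p%:R != 0 :> K -> F`_0 = 1 ->
  'X^(N.+1) %| F - root_series p p%:R^-1 F N ^+ p.
Proof.
move=> p_neq0 F0; elim: N => [|N IHN] /=.
  rewrite expr1n -['X]subr0 -polyC0 dvdp_XsubCl rootE !hornerE horner_coef0 F0.
  by rewrite subrr.
have := root_series0 p p%:R^-1 F N; set g := root_series _ _ _ _ in IHN *.
move=> g0; set a := _ * _`_ _.
have [Q defQ] := dvdpP _ _ IHN.
have defa : a = p%:R^-1 * Q.[0].
  by rewrite /a defQ coefMXn ltnn subnn horner_coef0.
have -> : F - (g + a%:P * 'X^(N.+1)) ^+ p =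
    F - g ^+ p - ((g + a%:P * 'X^(N.+1)) ^+ p - g ^+ p).
  by rewrite opprB addrA subrK.
(* The correction [a] is chosen so that [Q - a S] vanishes at [0], where
   [S(0) = p]. *)
rewrite subrXX [_ - g]addrC addKr defQ; set S := \sum_(_ < p) _.
rewrite (_ : _ - _ = (Q - a%:P * S) * 'X^(N.+1)); last by ring.
rewrite ['X^(N.+2)]exprS dvdp_mul2r ?monic_neq0 ?monicXn //.
rewrite -['X]subr0 -polyC0 dvdp_XsubCl rootE !hornerE defa horner_sum.
rewrite (eq_bigr (fun=> 1)) => [|i _]; last first.
  by rewrite !hornerE horner_coef0 g0 !expr0n /= mulr0 addr0 !expr1n mulr1.
by rewrite sumr_const card_ord mulrAC mulVf // mul1r subrr.
Qed.

(** * Linear systems depending polynomially on parameters *)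

(** If the matrix [M(v0)] has the right inverse [B], then [det (M(v) B)] is a
    polynomial in [v] which is [1] at [v0], and [M(v)] is injective wherever it
    does not vanish. *)
Lemma generic_injectivity (K : fieldType) n (S T : finType)
    (M : S -> T -> {mpoly K[n]}) (v0 : 'I_n -> K) :
  (forall c : T -> K, (forall s, \sum_t c t * (M s t).@[v0] = 0) -> c =1 fun=> 0) ->
  exists2 q : {mpoly K[n]}, q.@[v0] != 0 & forall v, q.@[v] != 0 ->
    forall c : T -> K, (forall s, \sum_t c t * (M s t).@[v] = 0) -> c =1 fun=> 0.
Proof.
pose A : 'M_(#|T|, #|S|) := \matrix_(i, j) M (enum_val j) (enum_val i).
pose A_ v := map_mx (meval v) A.
have kerA v (u : 'rV_#|T|) s :
    (u *m A_ v) 0 (enum_rank s) = \sum_t u 0 (enum_rank t) * (M s t).@[v].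
  rewrite mxE [RHS](reindex_onto (fun i : 'I_#|T| => enum_val i) enum_rank) /=;
    last by move=> t _; rewrite enum_rankK.
  apply: eq_big => [i|i _]; first by rewrite enum_valK eqxx.
  by rewrite !mxE enum_rankK enum_valK.
have ker_row v (c : T -> K) : (forall s, \sum_t c t * (M s t).@[v] = 0) ->
    (\row_i c (enum_val i)) *m A_ v = 0.
  move=> cM0; apply/rowP => j.
  rewrite -(enum_valK j) kerA mxE -[RHS](cM0 (enum_val j)).
  by apply: eq_bigr => t _; rewrite mxE enum_rankK.
move=> injM; have /row_freeP[B AB1] : row_free (A_ v0).
  rewrite -kermx_eq0; apply/eqP/row_matrixP => i; rewrite row0.
  apply/rowP => j; rewrite [RHS]mxE.
  have := injM (fun t => row i (kermx (A_ v0)) 0 (enum_rank t)) _ (enum_val j).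
  rewrite /= enum_valK; apply=> s; rewrite -kerA -row_mul mulmx_ker row0.
  by rewrite mxE.
pose BP := map_mx (@mpolyC n K) B; exists (\det (A *m BP)).
  rewrite -det_map_mx map_mxM -map_mx_comp map_mx_id_in => [|i j]; last first.
    by rewrite /= mevalC.
  by rewrite AB1 det1 oner_neq0.
move=> v; rewrite -det_map_mx map_mxM -/(A_ v) => detAB c /ker_row ker_c t.
have := congr1 (mulmx^~ (map_mx (meval v) BP)) ker_c.
rewrite /= -mulmxA mul0mx.
move/(congr1 (mulmx^~ (invmx (A_ v *m map_mx (meval v) BP)))).
rewrite mulmxK ?unitmxE ?unitfE // mul0mx => /rowP/(_ (enum_rank t)).
by rewrite !mxE enum_rankK.
Qed.

(** * Expansions at the points at infinity *)

(** With [t = 1/x] and [w = t^m y], this is [t^D u(x, y)] for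
    [u = sum_(i, k) c_(i, k) x^k y^i] and [D = s + p m], an exponent large enough
    to clear all the poles whatever [u]. *)
Definition polar_expansion (L : comNzRingType) (p s m : nat)
    (c : 'I_p * 'I_s -> L) (t w : L) : L :=
  \sum_(k : 'I_p * 'I_s) c k * (t ^+ (s + p * m - k.2 - k.1 * m) * w ^+ k.1).

(** The order of [u] at the point at infinity numbered [j] is
    [e j - (s + p m)] or more, where [g] is the branch [t^m y] at the point
    numbered [0]; only [u = 0] satisfies all these conditions. *)
Definition polar_injective (K : fieldType) p s m (z : K) (e : 'I_p -> nat)
    (g : {poly K}) :=
  forall c : 'I_p * 'I_s -> K,
    (forall j : 'I_p,
       'X^(e j) %| polar_expansion m (polyC \o c) 'X ((z ^+ j)%:P * g)) ->
  c =1 fun=> 0.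

(** Once shifted by [D], these are the vectors of orders with sum [>= 0] other
    than [0]; the bound [N] ensures that branches known modulo [t^N] are
    precise enough to test them. *)
Definition unbalanced p D N (e : 'I_p -> nat) : Prop :=
  [/\ forall j, (e j <= N)%N, (p * D <= \sum_j e j)%N & exists j, e j != D].

Lemma dvdp_polar_expansionB (K : fieldType) (d : {poly K}) p s m
    (c : 'I_p * 'I_s -> {poly K}) (t w w' : {poly K}) :
  d %| w - w' ->
  d %| polar_expansion m c t w - polar_expansion m c t w'.
Proof.
move=> dww; rewrite /polar_expansion -sumrB.
apply: (big_ind (fun x => d %| x)) => [||k _].
- exact: dvdp0.
- by move=> x y; apply: dvdp_add.
by rewrite -!mulrBr subrXX 2?dvdp_mull // dvdp_mulr.
Qed.

(** * The degenerate curve *)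

Lemma expr_1subXn (K : fieldType) p E :
  (1 - 'X^p) ^+ E = (1 - 'X) ^+ E \Po 'X^p :> {poly K}.
Proof. by rewrite rmorphXn /= comp_polyB comp_polyX comp_polyC. Qed.

Lemma coef_rational_term (K : fieldType) p E i l : (0 < p)%N ->
  ((1 - 'X^p) ^+ E * 'X^i : {poly K})`_l != 0 ->
  exists2 r, (r <= E)%N & (l = p * r + i)%N.
Proof.
move=> p_gt0; rewrite coefMXn; case: ltnP => [_|le_il]; first by rewrite eqxx.
rewrite expr_1subXn coef_comp_poly_Xn //; case: ifP => [p_dvd|_]; last by rewrite eqxx.
move=> nz; exists ((l - i) %/ p)%N; last by rewrite mulnC divnK // subnK.
rewrite -ltnS; apply: contraR nz; rewrite -leqNgt => leE.
rewrite nth_default // (leq_trans _ leE) // (leq_trans (size_poly_exp_leq _ _)) //.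
by rewrite -opprB size_polyN size_XsubC mul1n.
Qed.

(** Grouping the terms by the residue modulo [p] of the exponent of [w]
    separates the powers of [y]; for each of them, the powers of [1 - w^p] are
    linearly independent. *)
Lemma polar_expansion_rational_eq0 (K : fieldType) p s m (c : 'I_p * 'I_s -> K) :
  polar_expansion m (polyC \o c) (1 - 'X^p) 'X = 0 -> c =1 fun=> 0.
Proof.
move=> B0 [i k]; have p_gt0 : (0 < p)%N by apply: leq_ltn_trans (ltn_ord i).
pose E (i : 'I_p) (k : 'I_s) := (s + p * m - k - i * m)%N.
pose h i := \sum_k c (i, k) *: (1 - 'X) ^+ E i k.
have h0 : h i = 0.
  apply/polyP => l; rewrite coef0 -[RHS](coef0 K (p * l + i)) -B0.
  have -> : (polar_expansion m (polyC \o c) (1 - 'X^p) 'X)`_(p * l + i) =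
      \sum_i' \sum_k' c (i', k') * ((1 - 'X^p) ^+ E i' k' * 'X^i')`_(p * l + i).
    rewrite /polar_expansion coef_sum pair_bigA /=.
    by apply: eq_bigr => -[i' k'] _; rewrite coefCM.
  rewrite (bigD1 i) //= [X in _ + X]big1 ?addr0 => [|j ne_ji].
    rewrite coef_sum; apply: eq_bigr => k' _; rewrite coefZ; congr (_ * _).
    rewrite coefMXn ltnNge leq_addl /= addnK expr_1subXn.
    by rewrite coef_comp_poly_Xn // dvdn_mulr // mulKn.
  rewrite big1 // => k' _.
  apply/eqP; rewrite mulf_eq0 orbC; apply/orP; left; apply: contraT.
  case/(coef_rational_term p_gt0) => r _ eq_l; case/negP: ne_ji.
  rewrite -val_eqE /= -(modn_small (ltn_ord i)) -(modn_small (ltn_ord j)).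
  by rewrite -(modnMDl l i p) mulnC eq_l [(p * r)%N]mulnC modnMDl.
have /(congr1 (coefp (E i k))) : h i \Po (1 - 'X) = 0 by rewrite h0 comp_poly0.
rewrite /= coef0 rmorph_sum /= coef_sum (bigD1 k) //=.
have subK : (1 - 'X) \Po (1 - 'X) = 'X :> {poly K}.
  by rewrite comp_polyB comp_polyX comp_polyC subKr.
rewrite comp_polyZ rmorphXn /= subK coefZ coefXn eqxx mulr1 big1 ?addr0 //.
move=> k' ne_k'k; rewrite comp_polyZ rmorphXn /= subK coefZ coefXn.
case: eqP => [eqE|_]; last by rewrite mulr0.
case/eqP: ne_k'k; apply: val_inj => /=; move: eqE; rewrite /E.
have := ltn_ord k; have := ltn_ord k'; have := ltn_ord i.
nia.
Qed.

(** Where [t = 1 - w^p], the branches of the curve [w^p = 1 - t] are the function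
    [w] itself: [h = z g(1 - w^p)] satisfies [h^p = w^p] to high order at
    [w = z], and the factors of [h^p - w^p] other than [h - w] do not vanish
    there, because [h(z) = z]. *)
Lemma dvdp_branch_sub (K : fieldType) p N (z : K) (g : {poly K}) :
  p%:R != 0 :> K -> z ^+ p = 1 -> g`_0 = 1 -> 'X^N %| (1 - 'X) - g ^+ p ->
  ('X - z%:P) ^+ N %| z%:P * (g \Po (1 - 'X^p)) - 'X.
Proof.
move=> p_neq0 zp1 g0 g_root; have z_neq0 : z != 0.
  apply: contra_eq_neq zp1 => ->; case: p p_neq0 {g_root} => [|p _].
    by rewrite eqxx.
  by rewrite expr0n /= eq_sym oner_eq0.
set h := z%:P * _.
have hz : h.[z] = z.
  by rewrite /h !hornerE horner_comp !hornerE zp1 subrr horner_coef0 g0 mulr1.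
have : ('X - z%:P) ^+ N %| h ^+ p - 'X^p.
  apply: (@dvdp_trans _ ((1 - 'X^p) ^+ N)).
    by apply: dvdp_exp2r; rewrite dvdp_XsubCl rootE !hornerE zp1 subrr.
  have /(dvdp_comp_poly (1 - 'X^p)) := g_root.
  rewrite rmorphXn /= comp_polyX !comp_polyB comp_polyX comp_polyC rmorphXn /=.
  by rewrite subKr /h exprMn -polyC_exp zp1 mul1r -dvdpNr opprB.
rewrite subrXX Gauss_dvdpl //; apply: coprimep_expl.
rewrite coprimep_sym coprimep_XsubC rootE horner_sum.
rewrite (eq_bigr (fun=> z ^+ p.-1)) => [|i _].
  by rewrite sumr_const card_ord -mulr_natr mulf_neq0 // expf_neq0.
rewrite hornerM hornerXn horner_exp hz -exprD; congr (_ ^+ _).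
by have := ltn_ord i; lia.
Qed.

Lemma dvdp_prod_XsubC_exp (K : fieldType) (I : finType) (a : I -> K)
    (e : I -> nat) (B : {poly K}) : injective a ->
  (forall i, ('X - (a i)%:P) ^+ e i %| B) ->
  \prod_i ('X - (a i)%:P) ^+ e i %| B.
Proof.
move=> inj_a dvdB; elim: (index_enum I) (index_enum_uniq I) => [|i r IHr] /=.
  by rewrite big_nil dvd1p.
case/andP => r'i /IHr dvd_r; rewrite big_cons Gauss_dvdp ?dvdB //.
apply: coprimep_expl; rewrite big_seq; apply: (big_ind (coprimep _)) => [||j rj].
- exact: coprimep1.
- by move=> q q' cq cq'; rewrite coprimepMr cq.
apply/coprimep_expr/coprimep_XsubC2; rewrite subr_eq0 (inj_eq inj_a).
by apply: contraNneq r'i => <-.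
Qed.

Lemma prod_XsubC_exp_coefs (K : fieldType) (I : finType) (a : I -> K)
    (e : I -> nat) :
  let P := \prod_i ('X - (a i)%:P) ^+ e i in
  let d := (\sum_i e i)%N in
  size P = d.+1 /\ ((0 < d)%N -> P`_d.-1 = - \sum_i (e i)%:R * a i).
Proof.
move=> P d; pose r := flatten [seq nseq (e i) (a i) | i <- index_enum I].
have size_r : size r = d.
  rewrite size_flatten /shape -map_comp sumnE big_map.
  by apply: eq_bigr => i _; rewrite /= size_nseq.
have defP : P = \prod_(b <- r) ('X - b%:P).
  rewrite big_flatten big_map.
  by apply: eq_bigr => i _; rewrite big_nseq iter_mulr_1.
rewrite defP size_prod_XsubC size_r; split=> // d_gt0.
rewrite -size_r coefPn_prod_XsubC ?size_r -?lt0n // big_flatten big_map.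
by congr (- _); apply: eq_bigr => i _; rewrite big_nseq iter_addr_0 mulr_natl.
Qed.

(** The polynomial [B] is [u] written in the coordinate [w].  Its terms are
    combinations of [w^(p r + i)] with [i < p] and [r <= D - i m]: the degrees do
    not exceed [p D], and [p D - 1] does not occur because [p m > 2]. *)
Lemma rational_polar_injective (K : numFieldType) p m s N (z : K)
    (g : {poly K}) (e : 'I_p -> nat) :
  prime p -> (2 < p * m)%N -> p.-primitive_root z ->
  g`_0 = 1 -> 'X^N %| (1 - 'X) - g ^+ p ->
  unbalanced (s + p * m) N e -> polar_injective s m z e g.
Proof.
move=> pp pm_gt2 prim_z g0 g_root [le_eN le_De [j0 ne_ej0]] c dvd_c.
have p_gt1 := prime_gt1 pp; have p_gt0 := ltnW p_gt1.
pose B := polar_expansion m (polyC \o c) (1 - 'X^p) 'X.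
have [/polar_expansion_rational_eq0 // | B_neq0] := eqVneq B 0.
have coefB l : B`_l != 0 -> exists t : 'I_p * 'I_s,
    exists2 r, (r <= s + p * m - t.2 - t.1 * m)%N & (l = p * r + t.1)%N.
  rewrite coef_sum => nz.
  have [t nzt | all0] := pickP (fun t => ((polyC \o c) t *
      ((1 - 'X^p) ^+ (s + p * m - t.2 - t.1 * m) * 'X^(t.1)))`_l != 0).
    exists t; move: nzt; rewrite coefCM mulf_eq0 negb_or => /andP[_].
    exact: coef_rational_term.
  by case/eqP: nz; apply: big1 => t _; apply/eqP/negbFE/all0.
have zj_eq1 (j : nat) : (z ^+ j) ^+ p = 1.
  by rewrite exprAC (prim_expr_order prim_z) expr1n.
have dvdB (j : 'I_p) : ('X - (z ^+ j)%:P) ^+ e j %| B.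
  have p_neq0 : p%:R != 0 :> K by rewrite pnatr_eq0 -lt0n.
  have := dvdp_branch_sub p_neq0 (zj_eq1 j) g0 g_root.
  move/(dvdp_trans (dvdp_exp2l _ (le_eN j))).
  move/(dvdp_polar_expansionB m (polyC \o c) (1 - 'X^p)).
  rewrite dvdp_subr // (dvdp_trans (dvdp_exp2r _ (_ : _ %| 1 - 'X^p))) //.
    by rewrite dvdp_XsubCl rootE !hornerE zj_eq1 subrr.
  have /(dvdp_comp_poly (1 - 'X^p)) := dvd_c j.
  rewrite comp_Xn_poly rmorph_sum; congr (_ %| _); apply: eq_bigr => t _.
  by rewrite !(rmorphM, rmorphXn) /= !comp_polyC comp_polyX.
have inj_zX : injective (fun j : 'I_p => z ^+ j).
  move=> i j /eqP; rewrite (eq_prim_root_expr prim_z) !modn_small // => /eqP.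
  exact: val_inj.
have dvdPB := dvdp_prod_XsubC_exp inj_zX dvdB.
have [] := prod_XsubC_exp_coefs (fun j : 'I_p => z ^+ j) e.
set P := \prod_j _ in dvdPB *; set d := (\sum_j e j)%N => szP coefP.
have szB : (size B <= (p * (s + p * m)).+1)%N.
  apply/leq_sizeP => l lt_l; apply/eqP; apply: contraT.
  case/coefB=> -[i k] [r /= ler def_l].
  by have := ltn_ord i; have := ltn_ord k; nia.
have d_eq : d = (p * (s + p * m))%N.
  apply/eqP; rewrite eqn_leq le_De andbT -ltnS -szP.
  by rewrite (leq_trans _ szB) ?dvdp_leq.
have [a a_neq0 defB] : exists2 a, a != 0 & B = a *: P.
  apply/eqpf_eq; rewrite eqp_sym.
  by rewrite -dvdp_size_eqp // eqn_leq dvdp_leq // szP d_eq szB.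
have d_gt0 : (0 < d)%N by nia.
(* An exponent [p r + i = p D - 1] with [i < p] forces [i = p - 1] and
   [r = D - 1], so [(p - 1) m <= 1]. *)
have B_d1 : B`_d.-1 = 0.
  apply/eqP; apply: contraT => /coefB[[i k] [r /= ler]].
  rewrite d_eq; have lt_ip := ltn_ord i; set M := (s + p * m)%N in ler * => def_l.
  have eq_Mr : (p * M = p * r + i.+1)%N by move: d_gt0; rewrite d_eq -/M; lia.
  have eM : M = r.+1.
    apply/eqP; rewrite eqn_leq -(leq_pmul2l p_gt0) -(ltn_pmul2l p_gt0) mulnS.
    by lia.
  have ei : (nat_of_ord i = p.-1)%N by move: eq_Mr; rewrite eM mulnS; lia.
  have : (p.-1 * m <= 1)%N by move: ler; rewrite ei eM; lia.
  have m_gt0 : (0 < m)%N by case: (m) pm_gt2; rewrite ?muln0.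
  have : (m <= p.-1 * m)%N by rewrite leq_pmull // -ltnS prednK.
  by move: pm_gt2; rewrite -{1}(prednK p_gt0) mulSn; lia.
have /eqP := B_d1; rewrite defB coefZ coefP //.
rewrite mulrN oppr_eq0 mulf_eq0 (negPf a_neq0) /=.
move/eqP/(vanishing_sum_prime_roots pp prim_z) => e_const.
case/negP: ne_ej0; rewrite -(eqn_pmul2l p_gt0) -d_eq /d.
by rewrite (eq_bigr (fun=> e j0)) // sum_nat_const card_ord.
Qed.

(** * Orders at infinity of two inverse functions *)

Lemma cancel_pole (L : fieldType) (x a b : L) d k e : x != 0 ->
  a * (x ^+ d * b) = x ^+ (d + k + e) * (a / x ^+ k * (b / x ^+ e)).
Proof. by move=> x_neq0; rewrite !exprD; field; rewrite !expf_neq0. Qed.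

Lemma homogenize_product (L : fieldType) (x c g : L) d e n : x != 0 ->
  x ^+ e * x ^+ n *
      (x ^+ d * x ^+ d * (1 + c * (g / x ^+ n)) - x ^+ (d + d)) =
    x ^+ d * x ^+ d * (x ^+ e * c) * g.
Proof. by move=> x_neq0; rewrite !exprD; field; rewrite !expf_neq0. Qed.

Section Eval.
Context (K : fieldType) (m : nat).
Implicit Types (w g : {poly K}) (P u v : {poly {poly K}}).

Local Notation tofrac := (@tofrac _).
Local Notation tX := (tofrac ('X : {poly K})).

(** The value of [P(x, y)] at [x = 1/t] and [y = w / t^m], in the field [K(t)]. *)
Definition eval_at_infinity w : {poly {poly K}} -> {fraction {poly K}} :=
  horner_eval (tofrac w / tX ^+ m) \o
    map_poly (horner_eval tX^-1 \o map_poly (tofrac \o polyC)).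

HB.instance Definition _ w := GRing.RMorphism.on (eval_at_infinity w).

Definition coef2 p s P (k : 'I_p * 'I_s) : K := P`_k.1`_k.2.

Lemma tofracX_neq0 : tX != 0.
Proof. by rewrite tofrac_eq0 polyX_eq0. Qed.

Lemma polar_expansion_eval p s P w :
  (size P <= p)%N -> (forall i, size (P`_i)%R <= s)%N ->
  tofrac (@polar_expansion _ p s m (polyC \o coef2 P) 'X w) =
    tX ^+ (s + p * m) * eval_at_infinity w P.
Proof.
move=> szP szPi; have X_neq0 := tofracX_neq0.
have -> : eval_at_infinity w P = (map_poly (horner_eval tX^-1 \o
    map_poly (tofrac \o polyC)) P).[tofrac w / tX ^+ m] by [].
rewrite (horner_coef_wide _ (n := p)); last first.
  exact: leq_trans (size_poly _ _) szP.
rewrite mulr_sumr rmorph_sum /polar_expansion.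
transitivity (\sum_(i < p) \sum_(k < s) tX ^+ (s + p * m) *
    (tofrac (coef2 P (i, k))%:P * tX^-1 ^+ k * (tofrac w / tX ^+ m) ^+ i)).
  rewrite pair_bigA /=; apply: eq_bigr => -[i k] _ /=.
  rewrite !rmorphM !rmorphXn /= expr_div_n -exprM exprVn.
  have lt_ip := ltn_ord i; have lt_ks := ltn_ord k.
  have {2}-> : (s + p * m = (s + p * m - k - i * m) + k + m * i)%N by nia.
  exact: cancel_pole.
apply: eq_bigr => i _.
rewrite coef_map /= /horner_eval (horner_coef_wide _ (n := s)).
  rewrite mulr_suml mulr_sumr; apply: eq_bigr => k _.
  by rewrite coef_map /= mulrA.
by rewrite (leq_trans (size_poly _ _)).
Qed.

Lemma eval_at_infinityC w (a : {poly K}) :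
  eval_at_infinity w a%:P = (map_poly (tofrac \o polyC) a).[tX^-1].
Proof. by rewrite /eval_at_infinity /= map_polyC /horner_eval hornerC. Qed.

Lemma eval_curve_equation p n (lam : 'I_n -> K) w : n = (p * m)%N ->
  eval_at_infinity w (superelliptic_eq p (\prod_(i < n) ('X - (lam i)%:P))) =
  tofrac (w ^+ p - \prod_(i < n) (1 - (lam i)%:P * 'X)) / tX ^+ n.
Proof.
move=> def_n; have X_neq0 := tofracX_neq0.
rewrite /superelliptic_eq rmorphB rmorphXn /= eval_at_infinityC.
rewrite {1}/eval_at_infinity /= map_polyX /horner_eval hornerX.
rewrite expr_div_n -exprM.
rewrite mulnC -def_n [in RHS]rmorphB rmorphXn /= mulrBl; congr (_ - _).
rewrite !rmorph_prod horner_prod -[n in _ / tX ^+ n]card_ord -prodr_const.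
rewrite -prodf_div; apply: eq_bigr => i _.
rewrite rmorphB /= map_polyX map_polyC !hornerE rmorphB rmorphM rmorph1 /=.
by rewrite mulrBl mul1r mulfK.
Qed.
End Eval.

(** If [u v = 1] on the curve, the product of the expansions of [u] and [v]
    along an approximate branch [w] is [t^(2 D)] up to an error that becomes
    small with the precision of [w].  The precision [N0] depends only on the
    cofactor [q], whose poles at infinity must be compensated. *)
Lemma dvd_branch_productB (K : fieldType) p m s n (lam : 'I_n -> K)
    (u v q : {poly {poly K}}) D :
  n = (p * m)%N -> D = (s + p * m)%N -> (size u <= p)%N -> (size v <= p)%N ->
  (forall i, size (u`_i)%R <= s)%N -> (forall i, size (v`_i)%R <= s)%N ->
  u * v = 1 + q * superelliptic_eq p (\prod_(i < n) ('X - (lam i)%:P)) ->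
  exists N0, forall N (w : {poly K}), (N0 <= N)%N ->
    'X^N %| \prod_(i < n) (1 - (lam i)%:P * 'X) - w ^+ p ->
  'X^((D + D).+1) %| @polar_expansion _ p s m (polyC \o coef2 u) 'X w *
       @polar_expansion _ p s m (polyC \o coef2 v) 'X w - 'X^(D + D).
Proof.
move=> def_n def_D szu szv szui szvi uv1.
pose s' := (\max_(i < size q) size (q`_i)%R)%N.
have szqi i : (size (q`_i)%R <= s')%N.
  case: (ltnP i (size q)) => [lt_iq | le_qi].
    exact: (leq_bigmax (Ordinal lt_iq)).
  by rewrite nth_default // size_poly0.
exists (s' + size q * m + n).+1 => N w le_N w_root.
set U := polar_expansion _ _ _ _; set V := polar_expansion _ _ _ _.
pose Q := @polar_expansion _ (size q) s' m (polyC \o coef2 q) 'X w.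
have X_neq0 := tofracX_neq0 K.
have := congr1 (eval_at_infinity m w) uv1.
rewrite rmorphM rmorphD rmorph1 rmorphM /= (eval_curve_equation _ _ def_n) => uv1'.
rewrite -opprB dvdpNr in w_root; set G := w ^+ p - _ in w_root uv1'.
have eqUV : 'X^(s' + size q * m + n) * (U * V - 'X^(D + D)) = 'X^(D + D) * Q * G.
  apply/eqP; rewrite -tofrac_eq; apply/eqP.
  rewrite !tofracM tofracB tofracM !tofracXn !polar_expansion_eval // -def_D.
  move: uv1'; set a := _ m w u; set b := _ m w v; set c := _ m w q => eq_ab.
  rewrite mulrACA eq_ab exprD [in RHS]exprD.
  exact: homogenize_product.
have Xn0 : 'X^(s' + size q * m + n) != 0 :> {poly K}.
  by rewrite monic_neq0 ?monicXn.
rewrite -(dvdp_mul2l _ _ Xn0) eqUV mulrAC.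
apply/dvdp_mulr/(dvdp_trans _ (dvdp_mul (dvdpp _) w_root)).
by rewrite -!exprD dvdp_exp2l // addnS -addSn addnC leq_add2l.
Qed.

Lemma split_order (K : fieldType) d (U V : {poly K}) :
  'X^(d.+1) %| U * V - 'X^d ->
  exists e e', [/\ (e + e' = d)%N, 'X^e %| U & 'X^e' %| V].
Proof.
case/dvdpP => q defUV.
have UV l : (l <= d)%N -> (U * V)`_l = (l == d)%:R.
  move=> le_ld; rewrite -[U * V](subrK 'X^d) defUV coefD coefMXn ltnS le_ld.
  by rewrite add0r coefXn.
have [e [U' nzU' defU]] := multiplicity_XsubC U 0.
have [e' [V' nzV' defV]] := multiplicity_XsubC V 0.
rewrite polyC0 subr0 in defU defV.
have UV_neq0 : U * V != 0.
  apply/eqP => UV0; have /esym/eqP := UV d (leqnn d).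
  by rewrite UV0 coef0 eqxx oner_eq0.
move: (UV_neq0); rewrite mulf_eq0 negb_or => /andP[U_neq0 V_neq0].
rewrite U_neq0 /= in nzU'; rewrite V_neq0 /= in nzV'.
have defP : U * V = U' * V' * 'X^(e + e') by rewrite exprD defU defV; ring.
have coefP : (U * V)`_(e + e') != 0.
  by rewrite defP coefMXn ltnn subnn -horner_coef0 hornerM mulf_neq0.
exists e, e'; split; [|by rewrite defU dvdp_mull|by rewrite defV dvdp_mull].
apply/eqP; rewrite eqn_leq; apply/andP; split.
  rewrite leqNgt; apply/negP => lt_de; have /eqP := UV d (leqnn d).
  by rewrite defP coefMXn lt_de eqxx eq_sym oner_eq0.
rewrite leqNgt; apply: contra coefP => lt_ed.
by rewrite (UV _ (ltnW lt_ed)) (ltn_eqF lt_ed).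
Qed.

(** * Units with no polar relation are constant *)

(** For [f = prod_i (X - lam_i)], this is [t^n f(1/t)]. *)
Definition reversed_prod (A : comNzRingType) n (lam : 'I_n -> A) : {poly A} :=
  \prod_(i < n) (1 - (lam i)%:P * 'X).

Lemma reversed_prod0 (K : fieldType) n (lam : 'I_n -> K) :
  (reversed_prod lam)`_0 = 1.
Proof.
rewrite -horner_coef0 horner_prod big1 // => i _.
by rewrite !hornerE subr0.
Qed.

Lemma coef2_eq0 (K : fieldType) p s (P : {poly {poly K}}) :
  (size P <= p)%N -> (forall i, size (P`_i)%R <= s)%N ->
  (coef2 P : 'I_p * 'I_s -> K) =1 (fun=> 0) -> P = 0.
Proof.
move=> szP szPi P0; apply/polyP => i; apply/polyP => k; rewrite !coef0.
have [lt_ip | le_pi] := ltnP i p; last first.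
  by rewrite [P`_i]nth_default ?coef0 // (leq_trans szP).
have [lt_ks | le_sk] := ltnP k s; last first.
  by rewrite nth_default // (leq_trans (szPi i)).
exact: P0 (Ordinal lt_ip, Ordinal lt_ks).
Qed.

Lemma superelliptic_eq_proper (K : fieldType) p (f : {poly K}) q :
  (0 < p)%N -> 1 + q * superelliptic_eq p f != 0.
Proof.
move=> p_gt0; rewrite addr_eq0.
apply/eqP => /(congr1 (fun P : {poly _} => size P)).
rewrite size_polyN size_poly1; have [->|q_neq0] := eqVneq q 0.
  by rewrite mul0r size_poly0.
rewrite size_Mmonic ?monicXnsubC // size_XnsubC // addnS /=.
move: q_neq0 p_gt0; rewrite -size_poly_gt0.
by case: (size q) => // k; case: (p) => // p' _ _; rewrite addSn addnS.
Qed.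

(** The orders at infinity of [u] and of its inverse [v] are opposite, so one of
    the two vectors of orders has a sum [>= 0], and must be [0].  Both are thus
    [0], and [u - a] is excluded in turn, for [a] the value of [u] at the point
    numbered [0]. *)
Lemma unit_constant (K : fieldType) p m n (z : K) (lam : 'I_n -> K)
    (u v q : {poly {poly K}}) :
  (0 < p)%N -> p%:R != 0 :> K -> z ^+ p = 1 -> n = (p * m)%N ->
  (forall s N (e : 'I_p -> nat), unbalanced (s + p * m) N e ->
     polar_injective s m z e
       (root_series p p%:R^-1 (reversed_prod lam) N)) ->
  (size u <= p)%N -> (size v <= p)%N ->
  u * v = 1 + q * superelliptic_eq p (\prod_(i < n) ('X - (lam i)%:P)) ->
  exists2 a : K, a != 0 & u = a%:P%:P.
Proof.
move=> p_gt0 p_neq0 zp1 def_n inj szu szv uv1.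
pose xsize (P : {poly {poly K}}) := (\max_(i < size P) size (P`_i)%R)%N.
have le_xsize (P : {poly {poly K}}) i : (size (P`_i)%R <= xsize P)%N.
  case: (ltnP i (size P)) => [lt_iP | le_Pi].
    exact: (leq_bigmax (Ordinal lt_iP)).
  by rewrite nth_default // size_poly0.
pose s := (xsize u + xsize v).+1; pose D := (s + p * m)%N.
have szui i : (size (u`_i)%R <= s)%N by rewrite (leq_trans (le_xsize u i)) //; lia.
have szvi i : (size (v`_i)%R <= s)%N by rewrite (leq_trans (le_xsize v i)) //; lia.
have [N0 dvdUV] := dvd_branch_productB def_n (erefl D) szu szv szui szvi uv1.
pose N := maxn N0 (D + D).+1.
pose g := root_series p p%:R^-1 (reversed_prod lam) N.
have g_root j : 'X^N %| reversed_prod lam - ((z ^+ j)%:P * g) ^+ p.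
  rewrite exprMn -polyC_exp exprAC zp1 expr1n mul1r.
  apply: dvdp_trans (root_seriesP N p_neq0 (reversed_prod0 lam)).
  by rewrite dvdp_exp2l.
pose br (P : {poly {poly K}}) (j : 'I_p) : {poly K} :=
  polar_expansion m (polyC \o (coef2 P : 'I_p * 'I_s -> K)) 'X ((z ^+ j)%:P * g).
have /choice[e e_ord] (j : 'I_p) : exists e : nat * nat,
    [/\ (e.1 + e.2 = D + D)%N, 'X^(e.1) %| br u j & 'X^(e.2) %| br v j].
  have [e1 [e2 ord]] := split_order (dvdUV _ _ (leq_maxl _ _) (g_root j)).
  by exists (e1, e2).
have balanced (P : {poly {poly K}}) (d : 'I_p -> nat) : P != 0 -> (size P <= p)%N ->
    (forall i, size (P`_i)%R <= s)%N -> (forall j, (d j <= N)%N) ->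
    (p * D <= \sum_j d j)%N -> (forall j, 'X^(d j) %| br P j) ->
    forall j, d j = D.
  move=> P_neq0 szP szPi le_dN le_Dd dvdP j; apply/eqP; apply: contraNT P_neq0.
  move=> dj; apply/eqP/(coef2_eq0 szP szPi)/(inj s N d _ _ dvdP).
  by split=> //; exists j.
have [u_neq0 v_neq0] : u != 0 /\ v != 0.
  apply/andP; rewrite -negb_or -mulf_eq0 uv1.
  exact: superelliptic_eq_proper.
have e1D j : (e j).1 = D.
  have [le_De1 | lt_e1D] := leqP (p * D) (\sum_j (e j).1).
    apply: (balanced u (fun j => (e j).1) u_neq0 szu szui) => // i.
      by have [? _ _] := e_ord i; rewrite leq_max; apply/orP; right; lia.
    by case: (e_ord i).
  have e2D i : (e i).2 = D.
    apply: (balanced v (fun j => (e j).2) v_neq0 szv szvi) => [k||k].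
    - by have [? _ _] := e_ord k; rewrite leq_max; apply/orP; right; lia.
    - have : (\sum_j (e j).1 + \sum_j (e j).2 = p * (D + D))%N.
        rewrite -big_split /= (eq_bigr (fun=> (D + D)%N)) => [|i' _]; last first.
          by case: (e_ord i').
        by rewrite sum_nat_const card_ord.
      by lia.
    by case: (e_ord k).
  by have [] := e_ord j; rewrite e2D; lia.
pose j0 := Ordinal p_gt0.
have [W defW] : exists W, br u j0 = W * 'X^D.
  by have [_ + _] := e_ord j0; rewrite e1D => /dvdpP.
pose a := W.[0]; pose P := u - a%:P%:P.
have [P0 | P_neq0] := eqVneq P 0.
  have def_u : u = a%:P%:P by apply/eqP; rewrite -subr_eq0 -/P P0.
  exists a => //; apply: contraNneq u_neq0 => a0.
  by rewrite def_u a0.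
have szP : (size P <= p)%N.
  rewrite (leq_trans (size_polyD _ _)) // size_polyN geq_max szu.
  by rewrite (leq_trans (size_polyC_leq1 _)).
have szPi i : (size (P`_i)%R <= s)%N.
  rewrite coefB (leq_trans (size_polyD _ _)) // size_polyN geq_max szui coefC.
  case: ifP => _; last by rewrite size_poly0.
  exact: leq_trans (size_polyC_leq1 _) _.
have brP j : br P j = br u j - a%:P * 'X^D.
  apply/eqP; rewrite -tofrac_eq; apply/eqP.
  rewrite tofracB tofracM tofracXn !polar_expansion_eval // rmorphB /=.
  rewrite eval_at_infinityC map_polyC hornerC mulrBr; congr (_ - _).
  exact: mulrC.
pose d (j : 'I_p) := if j == j0 then D.+1 else D.
suff /(_ j0) : forall j, d j = D by rewrite /d eqxx; lia.
apply: (balanced P d P_neq0 szP szPi) => [j||j]; rewrite /d.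
- by rewrite leq_max; apply/orP; right; case: ifP => _; lia.
- apply: (@leq_trans (\sum_(j < p) D)); first by rewrite sum_nat_const card_ord.
  by apply: leq_sum => j _; case: ifP.
rewrite brP; case: eqP => [-> | _]; last first.
  rewrite dvdp_sub // ?dvdp_mull //.
  by have [_ + _] := e_ord j; rewrite e1D.
rewrite defW -mulrBl exprS dvdp_mul2r ?monic_neq0 ?monicXn //.
by rewrite -['X]subr0 -polyC0 dvdp_XsubCl rootE !hornerE subrr.
Qed.

(** * Specialization and the main result *)

(** At this point, [prod_i (x - lam_i) = x^(n-1) (x - 1)]. *)
Definition rational_point (K : nzRingType) n (i : 'I_n) : K := (i == 0 :> nat)%:R.

Lemma dvdp_XnP (K : fieldType) e (P : {poly K}) :
  'X^e %| P <-> forall l, (l < e)%N -> P`_l = 0.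
Proof.
split=> [/dvdpP[q ->] l lt_le | P0]; first by rewrite coefMXn lt_le.
rewrite -(poly_take_drop e P) dvdp_addl ?dvdp_mull //.
rewrite (_ : take_poly e P = 0) ?dvdp0 //.
by apply/polyP => l; rewrite coef_take_poly coef0; case: ifP => // /P0.
Qed.

Lemma reversed_prod_rational (K : comNzRingType) n : (0 < n)%N ->
  reversed_prod (@rational_point K n) = 1 - 'X.
Proof.
case: n => // n _; rewrite /reversed_prod big_ord_recl big1 => [|i _].
  by rewrite mul1r mulr1.
by rewrite /rational_point /= mul0r subr0.
Qed.

(** The divisibility conditions are linear equations in the coefficients of [u];
    taking the indeterminates for [lam] writes their matrix over a polynomial
    ring. *)
Lemma generic_polar_injective (K : numFieldType) p m n s N (z : K)
    (e : 'I_p -> nat) :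
  prime p -> (2 < n)%N -> n = (p * m)%N -> p.-primitive_root z ->
  unbalanced (s + p * m) N e ->
  exists2 q : {mpoly K[n]}, q.@[@rational_point K n] != 0 &
    forall lam, q.@[lam] != 0 ->
      polar_injective s m z e (root_series p p%:R^-1 (reversed_prod lam) N).
Proof.
move=> pp n_gt2 def_n prim_z unb; have [le_eN _ _] := unb.
pose g := root_series p (p%:R^-1)%:MP
  (reversed_prod (fun i : 'I_n => 'X_i : {mpoly K[n]})) N.
pose M (j : 'I_p * 'I_N) (k : 'I_p * 'I_s) : {mpoly K[n]} :=
  if (j.2 < e j.1)%N then
    ('X^(s + p * m - k.2 - k.1 * m) * (((z ^+ j.1)%:MP)%:P * g) ^+ k.1)`_(j.2)
  else 0.
pose g_ lam := root_series p p%:R^-1 (@reversed_prod K n lam) N.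
have map_g lam : map_poly (meval lam) g = g_ lam.
  rewrite /g map_root_series /= mevalC; congr root_series.
  rewrite rmorph_prod; apply: eq_bigr => i _.
  by rewrite rmorphB rmorphM rmorph1 /= map_polyX map_polyC /= mevalXU.
have evalM lam (c : 'I_p * 'I_s -> K) (j : 'I_p * 'I_N) :
    \sum_k c k * (M j k).@[lam] = if (j.2 < e j.1)%N then
      (polar_expansion m (polyC \o c) 'X ((z ^+ j.1)%:P * g_ lam))`_(j.2) else 0.
  rewrite /M; case: ifP => _; last by rewrite big1 // => k _; rewrite meval0 mulr0.
  rewrite coef_sum; apply: eq_bigr => k _.
  rewrite coefCM -coef_map; congr (_ * _`__).
  rewrite !(rmorphM, rmorphXn) /= map_polyX map_polyC /= map_g.
  by rewrite -rmorphXn /= mevalC ?rmorphXn.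
have injE lam : (forall c : 'I_p * 'I_s -> K,
      (forall j, \sum_k c k * (M j k).@[lam] = 0) -> c =1 fun=> 0) <->
    polar_injective s m z e (g_ lam).
  split=> inj c c0; apply: inj.
    move=> [j l]; rewrite evalM /=; case: ifP => // lt_le.
    by have /dvdp_XnP := c0 j; apply.
  move=> j; apply/dvdp_XnP => l lt_le; have lt_lN := leq_trans lt_le (le_eN j).
  by have := c0 (j, Ordinal lt_lN); rewrite evalM /= lt_le.
have [|q q0 inj_q] := @generic_injectivity K n _ _ M (@rational_point K n).
  apply/(injE _).2/(rational_polar_injective (N := N)) => //.
  - by rewrite -def_n.
  - exact: root_series0.
  rewrite /g_ reversed_prod_rational ?(ltnW (ltnW n_gt2)) //.
  apply: dvdp_trans (root_seriesP N _ _); first by rewrite dvdp_exp2l.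
  - by rewrite pnatr_eq0 -lt0n prime_gt0.
  - by rewrite coefB coef1 coefX subr0.
by exists q => // lam /inj_q inj; apply: (injE lam).1 inj.
Qed.

Lemma primitive_root_exists (K : closedFieldType) n : (n%:R != 0 :> K) ->
  exists z : K, n.-primitive_root z.
Proof.
move=> n_neq0; have n_gt0 : (0 < n)%N by case: n n_neq0; rewrite ?eqxx.
pose P : {poly K} := 'X^n - 1; have [r defP] := closed_field_poly_normal P.
rewrite (monicP _) ?monicXnsubC // scale1r in defP.
have r1 : all n.-unity_root r by apply/allP => z; rewrite -root_prod_XsubC -defP.
have size_r : (n < (size r).+1)%N.
  by rewrite -(size_prod_XsubC r id) -defP size_XnsubC.
have [|z _ prim_z] := hasP (has_prim_root n_gt0 r1 _ size_r); last by exists z.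
by rewrite -separable_prod_XsubC -defP separable_Xn_sub_1.
Qed.

Lemma qpoly_mul_eq1 (A : comNzRingType) (h : {poly A}) (u v : {poly %/ h}) :
  u * v = 1 -> exists q, (u : {poly A}) * v = 1 + q * mk_monic h.
Proof.
move=> /(congr1 val) /= uv1.
exists (Pdiv.Ring.rdivp ((u : {poly A}) * v) (mk_monic h)).
by rewrite {1}(Pdiv.RingMonic.rdivp_eq (monic_mk_monic h) (_ * _)) uv1 addrC.
Qed.

Theorem proposition3p6 (R : realType) (p n : nat) (hp : prime p)
    (hn : (3 <= n)%N) (hpn : (p %| n)%N) :
  sufficiently_general (fun lam : 'I_n -> R[i] =>
    let f : {poly R[i]} := \prod_(i < n) ('X - (lam i)%:P) in
    ring_units (coord_ring p f) = nonzero_constants p f).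
Proof.
have p_gt0 := prime_gt0 hp.
have p_neq0 : p%:R != 0 :> R[i] by rewrite pnatr_eq0 -lt0n.
have [z prim_z] := primitive_root_exists p_neq0.
have [m def_n] : exists m, n = (p * m)%N.
  by exists (n %/ p)%N; rewrite mulnC divnK.
(* Vectors of orders are encoded as sequences, so that the conditions are indexed
   by the countable type of triples (degree bound, precision, orders). *)
pose e_ (l : seq nat) (j : 'I_p) := nth 0%N l j.
have /choice[q q_spec] (x : nat * nat * seq nat) : exists q : {mpoly R[i][n]},
    q.@[@rational_point _ n] != 0 /\
    (unbalanced (x.1.1 + p * m) x.1.2 (e_ x.2) -> forall lam, q.@[lam] != 0 ->
      polar_injective x.1.1 m z (e_ x.2)
        (root_series p p%:R^-1 (reversed_prod lam) x.1.2)).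
  have [unb | balanced] := pselect (unbalanced (x.1.1 + p * m) x.1.2 (e_ x.2)).
    by have [q q0 inj] := generic_polar_injective hp hn def_n prim_z unb; exists q.
  by exists 1; rewrite meval1 oner_eq0.
(* The default value serves the integers that encode no triple; any hypersurface
   that avoids the rational point would do. *)
pose nth_index k : nat * nat * seq nat :=
  odflt (0%N, 0%N, [::]) (unpickle k).
exists (fun k => [set lam | (q (nth_index k)).@[lam] = 0]).
split=> [k | lam _ lamZ f].
  split.
    exists [set q (nth_index k)].
    by apply/seteqP; split=> [lam q0 _ -> //|lam]; exact.
  have [q0 _] := q_spec (nth_index k).
  by move/seteqP => [_ /(_ (@rational_point _ n) I)] /eqP; apply/negP.
have inj s N (e : 'I_p -> nat) : unbalanced (s + p * m) N e ->
    polar_injective s m z e (root_series p p%:R^-1 (reversed_prod lam) N).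
  pose x := (s, N, codom e); have e_x : e_ x.2 = e.
    apply/funext => j; rewrite /e_ /= codomE (nth_map j) ?size_enum_ord //.
    by rewrite nth_ord_enum.
  have [_] := q_spec x; rewrite e_x => /[apply]; apply.
  apply/eqP => qx0; apply: lamZ; exists (pickle x) => //=.
  by rewrite /nth_index pickleK.
have defh := mk_monic_superelliptic_eq f p_gt0.
have size_h : size (superelliptic_eq p f) = p.+1 by rewrite size_XnsubC.
have size_u (u : coord_ring p f) : (size (u : {poly {poly R[i]}}) <= p)%N.
  rewrite -ltnS; apply: leq_trans (size_mk_monic u) _.
  by apply: eq_leq; rewrite -size_h -[in RHS]defh.
apply/seteqP; split=> u.
  case=> v /qpoly_mul_eq1[r]; rewrite [X in r * X]defh => uv.
  have [a a_neq0 def_u] := unit_constant p_gt0 p_neq0 (prim_expr_order prim_z)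
    def_n inj (size_u u) (size_u v) uv.
  by exists a => //; apply: val_inj.
case=> a /= a_neq0 <-; exists (qpolyC _ a^-1%:P).
by rewrite -rmorphM -polyCM mulfV // rmorph1.
Qed.
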